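(* Let $G=(V,E)$ be a finite connected weighted graph, and let $b,c:V\to\mathbb{R}$ satisfy $b(x)\ge 0$ and $c(x)>0$ for all $x\in V$. If $u:V\to\mathbb{R}$ satisfies $-\Delta_V u-\vec{b}\cdot\nabla u+c(x)u\ge 0$ on $V$, then $u(x)\ge 0$ for all $x\in V$.
   Context: $G=(V,E)$ is a finite, undirected, connected graph with a weight $\omega:V\times V\to[0,\infty)$, $\omega_{xy}=\omega_{yx}$, $\omega_{xy}=0$ if and only if $xy\notin E$, and a measure $\mu:V\to(0,\infty)$. The graph Laplacian is $\Delta_V u(x)=\sum_{y\in V}(u(y)-u(x))\frac{\omega_{yx}}{\mu(x)}$. With $\vec b=(b(x))_{x\in V}$ and $\nabla u(x)=\big((u(y)-u(x))\sqrt{\omega_{xy}/(2\mu(x))}\big)_{y\sim x}$, one sets $(\vec b\cdot\nabla u)(x)=\sum_{y\sim x}b(y)(u(y)-u(x))\sqrt{\frac{\omega_{xy}}{2\mu(x)}}$. *)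

(* Defs.v *)
From mathcomp Require Import all_boot all_order all_algebra.
From mathcomp Require Import reals.

Set Implicit Arguments.
Unset Strict Implicit.
Unset Printing Implicit Defensive.

Import Order.TTheory GRing.Theory Num.Theory.
Local Open Scope ring_scope.

(* Loops are not excluded: they contribute 0 to every sum below, since
   u x - u x = 0. *)
Record weighted_graph (R : realType) (V : finType) := WeightedGraph {
  edge : rel V;
  weight : V -> V -> R;
  measure : V -> R;
  edge_sym : symmetric edge;
  edge_connected : forall x y : V, connect edge x y;
  weight_ge0 : forall x y : V, 0 <= weight x y;
  weight_sym : forall x y : V, weight x y = weight y x;
  weight_eq0 : forall x y : V, weight x y = 0 <-> ~~ edge x y;
  measure_gt0 : forall x : V, 0 < measure x
}.

Definition laplacian (R : realType) (V : finType) (G : weighted_graph R V)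
    (u : V -> R) (x : V) : R :=
  \sum_(y : V) (u y - u x) * (weight G y x / measure G x).

(* The y-th component of the gradient of u at x; only the components with
   y adjacent to x are meant (and the others are 0). *)
Definition gradient (R : realType) (V : finType) (G : weighted_graph R V)
    (u : V -> R) (x y : V) : R :=
  (u y - u x) * Num.sqrt (weight G x y / (2 * measure G x)).

Definition drift (R : realType) (V : finType) (G : weighted_graph R V)
    (b u : V -> R) (x : V) : R :=
  \sum_(y : V | edge G x y) b y * gradient G u x y.

(* Main.v *)
Require Import Defs.
From mathcomp Require Import all_boot all_order all_algebra.
From mathcomp Require Import reals.

(** This is a minimum principle. On a finite graph [u] attains its minimum, at
    [x0] say. Every increment [u y - u x0] is then nonnegative, and both
    operators are combinations of these increments with nonnegative
    coefficients ([laplacian_ge0_at_min], and [drift_ge0_at_min] where the sign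
    of [b] enters). The inequality at [x0] therefore leaves
    [0 <= c x0 * u x0], and positivity of [c] gives [0 <= u x0]. *)

Import Order.TTheory GRing.Theory Num.Theory.
Local Open Scope ring_scope.

Lemma laplacian_ge0_at_min (R : realType) (V : finType)
    (G : weighted_graph R V) (u : V -> R) (x : V) :
  (forall y, u x <= u y) -> 0 <= laplacian G u x.
Proof.
move=> min_x; apply: sumr_ge0 => y _.
by rewrite mulr_ge0 ?subr_ge0 // divr_ge0 ?weight_ge0 // ltW ?measure_gt0.
Qed.

Lemma drift_ge0_at_min (R : realType) (V : finType) (G : weighted_graph R V)
    (b u : V -> R) (x : V) :
  (forall y, 0 <= b y) -> (forall y, u x <= u y) -> 0 <= drift G b u x.
Proof.
move=> b_ge0 min_x; apply: sumr_ge0 => y _.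
by rewrite mulr_ge0 // mulr_ge0 ?subr_ge0 // sqrtr_ge0.
Qed.

Theorem theorem3p9 (R : realType) (V : finType) (G : weighted_graph R V)
  (b c : V -> R)
  (hb : forall x : V, 0 <= b x)
  (hc : forall x : V, 0 < c x)
  (u : V -> R)
  (hu : forall x : V, 0 <= - laplacian G u x - drift G b u x + c x * u x) :
  forall x : V, 0 <= u x.
Proof.
move=> x.
have [x0 _ min_x0] := @arg_minP _ _ _ x predT u isT.
have {}min_x0 y : u x0 <= u y by exact: min_x0.
apply: le_trans (min_x0 x).
rewrite -(pmulr_rge0 _ (hc x0)).
have := hu x0; rewrite -opprD addrC subr_ge0; apply: le_trans.
by rewrite addr_ge0 ?laplacian_ge0_at_min ?drift_ge0_at_min.
Qed.
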